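(* Let $G$ be a parsimonious game with $h\ge 2$ types of players and free type representation $(x_1,\ldots,x_{h-1})$. Then the minimal winning quota of $G$ equals $q_h$, where the sequence $q_0,q_1,\ldots,q_h$ is the solution of the second order, linear, homogeneous finite difference equation (with in general nonconstant coefficients) $$q_t = x_{t-1}\cdot q_{t-1}+q_{t-2}\qquad (2\le t\le h),$$ with initial conditions $q_0=0$ and $q_1=1$.
   Context: A constant sum homogeneous weighted majority game on a finite player set $N$ is a simple game ($v(S)\in\{0,1\}$ for every $S\subseteq N$), constant sum ($v(S)+v(N\setminus S)=1$), admitting a (unique) minimal homogeneous representation $(q,\mathbf{w})$: the individual weights $w_j$ are integers in nondecreasing order, some players have weight $1$, $v(S)=1$ if and only if $w(S):=\sum_{j\in S}w_j\ge q$, with $q=\frac{1+w(N)}{2}$, and $w(S)=q$ for every minimal winning coalition $S$ (a coalition with $v(S)=1$ and $v(T)=0$ for all $T\subsetneq S$). The number $q$ is the minimal winning quota of the game. A parsimonious game ($P$ game) is a constant sum homogeneous weighted majority game with $n>3$ players, none of them dummy, having exactly $n$ minimal winning coalitions (the smallest possible number). Recalled facts about $P$ games (known, due to earlier work). Group the players by equal weight in the minimal homogeneous representation into $h$ types ($2\le h\le n-2$) with type weights $w_1<w_2<\cdots<w_h$, and let $x_t\geq 1$ be the number of players of type $t$. Then $x_1>1$, $x_{h-1}>1$, $x_h=1$. The vector $(x_1,\ldots,x_h)$ is the type representation, and $(x_1,\ldots,x_{h-1})$ is the free type representation; it determines the game. With the convention $w_0=0$, the type weights satisfy $w_1=1$,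 $w_t=x_{t-1}w_{t-1}+w_{t-2}$ for $1<t<h$, and $w_h=(x_{h-1}-1)w_{h-1}+w_{h-2}$. *)

(* Defs.v *)
From mathcomp Require Import all_boot.

Set Implicit Arguments.
Unset Strict Implicit.
Unset Printing Implicit Defensive.

(* A simple game on the finite player set N is its characteristic function    *)
(* v : {set N} -> bool; the values 0 and 1 are read through the coercion      *)
(* bool >-> nat.  The minimal winning coalitions are the S with minset v S.   *)

Definition constant_sum (N : finType) (v : {set N} -> bool) : Prop :=
  forall S : {set N}, v S + v (~: S) = 1.

Definition coalition_weight (N : finType) (w : N -> nat) (S : {set N}) : nat :=
  \sum_(j in S) w j.

(* The quota equation q = (1 + w(N)) / 2 is exact division, hence the         *)
(* doubling.  The players are not listed in order of weight here: the order   *)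
(* only fixes a labelling of N, and is recovered in type_weights below.       *)
Definition minimal_homogeneous_representation (N : finType)
    (v : {set N} -> bool) (q : nat) (w : N -> nat) : Prop :=
  [/\ exists j : N, w j = 1,
      forall S : {set N}, v S = (q <= coalition_weight w S),
      2 * q = 1 + coalition_weight w [set: N]
    & forall S : {set N}, minset v S -> coalition_weight w S = q].

Definition dummy (N : finType) (v : {set N} -> bool) (i : N) : Prop :=
  forall S : {set N}, v (i |: S) = v S.

Definition parsimonious (N : finType) (v : {set N} -> bool) : Prop :=
  [/\ constant_sum v,
      exists (q : nat) (w : N -> nat), minimal_homogeneous_representation v q w,
      3 < #|N|,
      forall i : N, ~ dummy v i
    & #|[set S : {set N} | minset v S]| = #|N|].

(* The distinct individual weights, in increasing order. *)
Definition type_weights (N : finType) (w : N -> nat) : seq nat :=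
  sort leq (undup [seq w j | j : N]).

Definition num_types (N : finType) (w : N -> nat) : nat :=
  size (type_weights w).

(* Types are numbered from 1, with the convention w_0 = 0. *)
Definition type_weight (N : finType) (w : N -> nat) (t : nat) : nat :=
  nth 0 (0 :: type_weights w) t.

(* The t-th component x_t of the type representation, for 1 <= t <= h. *)
Definition type_size (N : finType) (w : N -> nat) (t : nat) : nat :=
  #|[set j : N | w j == type_weight w t]|.

Definition solves_difference_equation (x : nat -> nat) (h : nat)
    (s : nat -> nat) : Prop :=
  [/\ s 0 = 0, s 1 = 1
    & forall t : nat, 2 <= t <= h -> s t = x t.-1 * s t.-1 + s t.-2].

(* Main.v *)
Require Import Defs.
From mathcomp Require Import all_boot.
From mathcomp Require Import zify.

(* Let the players choose in order of decreasing weight, and let M(P) be the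
   number of subsets of the initial segment P that are still undecided (losing,
   but winning together with all the remaining players).  Homogeneity forbids
   overshooting the quota, and the constant sum pairs the coalitions that just
   met it with those that just became hopeless, so the number of minimal winning
   coalitions is 1 + (sum of M(P) over P nonempty and proper) / 2.  Each such
   M(P) is even, and positive since there are no dummies; with only n minimal
   winning coalitions, every M(P) is 2.  Following the two complementary
   undecided coalitions through consecutive players i, j of distinct weights
   gives w(i) = 1 + (total weight of the players after j), and the quota is
   both the sum of the two largest weights and 1 + (the sum of all the others).
   Subtracting these balances for consecutive types gives the recurrence. *)

Set Implicit Arguments.
Unset Strict Implicit.
Unset Printing Implicit Defensive.

Lemma setDDK (T : finType) (A B : {set T}) : A \subset B -> B :\: (B :\: A) = A.
Proof. by move=> sAB; rewrite setDDr setDv set0U (setIidPr sAB). Qed.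

Lemma setD_fixed (T : finType) (A B : {set T}) : A = B :\: A -> B = set0.
Proof.
move/setP=> eqA; apply/setP => x; rewrite inE.
by have := eqA x; rewrite inE; case: (x \in A); case: (x \in B).
Qed.

Section Parsimonious.

Variables (N : finType) (v : {set N} -> bool) (q : nat) (w : N -> nat).
Hypothesis v_pars : parsimonious v.
Hypothesis w_rep : minimal_homogeneous_representation v q w.

Implicit Types (P Q A B S : {set N}) (i j k : N).

(** * Coalition weights, homogeneity and pivotal players *)

Local Notation wt := (coalition_weight w).

Lemma wtU1 i A : i \notin A -> wt (i |: A) = w i + wt A.
Proof. exact: big_setU1. Qed.

Lemma wtD1 i A : i \in A -> wt A = w i + wt (A :\ i).
Proof. exact: big_setD1. Qed.

Lemma wt0 : wt set0 = 0.
Proof. exact: big_set0. Qed.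

Lemma wt1 i : wt [set i] = w i.
Proof. exact: big_set1. Qed.

Lemma wtID A B : wt A = wt (A :&: B) + wt (A :\: B).
Proof. exact: big_setID. Qed.

Lemma wtD A B : B \subset A -> wt A = wt B + wt (A :\: B).
Proof. by move=> sBA; rewrite (wtID A B) (setIidPr sBA). Qed.

Lemma wtS A B : A \subset B -> wt A <= wt B.
Proof. by move=> /wtD ->; rewrite leq_addr. Qed.

Lemma wtU A B : [disjoint A & B] -> wt (A :|: B) = wt A + wt B.
Proof.
rewrite disjoint_sym => dAB.
by rewrite (wtD (subsetUl A B)) setDUl setDv set0U (setDidPl dAB).
Qed.

Lemma vE S : v S = (q <= wt S).
Proof. by case: w_rep. Qed.

Lemma wtT : 2 * q = 1 + wt [set: N].
Proof. by case: w_rep. Qed.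

Lemma wtC P : wt P + wt (~: P) + 1 = 2 * q.
Proof. by rewrite wtT (wtD (subsetT P)) setTD addnC addnA. Qed.

Lemma cardN_gt3 : 3 < #|N|.
Proof. by case: v_pars. Qed.

Lemma not_dummyP i : exists2 S : {set N}, i \notin S & wt S < q <= wt (i |: S).
Proof.
have [_ _ _ ndum _] := v_pars.
have [S /= /eqP neqS | eqv] :=
  pickP [pred S : {set N} | v (i |: S) != v S]; last first.
  by case: (ndum i) => S; apply/eqP; have := eqv S => /= /negbFE.
have iS : i \notin S.
  apply/negP => iS; apply: neqS; congr v; apply/setP => x.
  by rewrite in_setU1; case: eqP => // ->.
exists S => //; move: neqS; rewrite !vE wtU1 //; lia.
Qed.

Lemma w_gt0 i : 0 < w i.
Proof. by have [S iS] := not_dummyP i; rewrite wtU1 //; lia. Qed.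

Lemma q_gt0 : 0 < q.
Proof. by have := wtT; lia. Qed.

(** Homogeneity gives one direction; conversely all weights are positive, so a coalition of weight
    [q] loses as soon as a player leaves. *)
Lemma minset_wt S : minset v S = (wt S == q).
Proof.
apply/idP/eqP => [|wSq]; first by case: w_rep => _ _ _; apply.
apply/minsetP; split=> [|T]; first by rewrite vE wSq.
rewrite vE => qT sTS; apply/eqP; rewrite eqEsubset sTS /=.
apply/subsetP => x xS; apply: contraT => xT.
have sT : T \subset S :\ x by rewrite subsetD1 sTS.
by have := wtS sT; have := wtD1 xS; have := w_gt0 x; lia.
Qed.

Lemma card_wt_eq_quota : #|[set S | wt S == q]| = #|N|.
Proof.
by case: v_pars => _ _ _ _ <-; apply: eq_card => S; rewrite !inE minset_wt.
Qed.

(** Were the quota overshot, dropping any player of [i |: A], none lighter than [i], would leave at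
    most [wt A], a losing weight; so [i |: A] would be minimal winning with weight above [q]. *)
Lemma losing_add_lighter i A :
    i \notin A -> {in A, forall x, w i <= w x} -> wt A < q ->
  w i + wt A <= q.
Proof.
move=> iA leA ltA; rewrite leqNgt; apply/negP => gtq.
suff: minset v (i |: A) by rewrite minset_wt wtU1 //; lia.
apply/minsetP; split=> [|T]; first by rewrite vE wtU1 //; lia.
rewrite vE => qT sT; apply/eqP; rewrite eqEsubset sT /=.
apply/subsetP => x xS; apply: contraT => xT.
have sT' : T \subset (i |: A) :\ x by rewrite subsetD1 sT.
have le_ix : w i <= w x.
  by move: xS; rewrite in_setU1 => /predU1P[-> | /leA].
by have := wtS sT'; have := wtD1 xS; rewrite wtU1 //; lia.
Qed.

(** * Initial segments of players and their undecided coalitions *)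

(** An initial segment in some order of decreasing weight; ties may be broken either way. *)
Definition upper P := forall x y, x \in P -> y \notin P -> w y <= w x.

Definition undecided P :=
  [set A : {set N} | (A \subset P) && (wt A < q <= wt A + wt (~: P))].

Definition completed P i :=
  [set A : {set N} | (A \subset P) && (w i + wt A == q)].

(** By [minset_wt], the minimal winning coalitions contained in [P]. *)
Definition won_in P := [set S : {set N} | (S \subset P) && (wt S == q)].

Lemma upperT : upper [set: N].
Proof. by move=> x y _; rewrite inE. Qed.

Lemma upper0 : upper set0.
Proof. by move=> x y; rewrite inE. Qed.

Lemma upperD1_min Q i :
  upper Q -> {in Q, forall x, w i <= w x} -> upper (Q :\ i).
Proof.
move=> upQ mini x y /setD1P[_ xQ]; rewrite in_setD1 negb_and negbK.
by case/orP => [/eqP-> | yQ]; [apply: mini | apply: upQ].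
Qed.

Lemma upperU1_max P i :
  upper P -> {in ~: P, forall x, w x <= w i} -> upper (i |: P).
Proof.
move=> upP maxi x y xP; rewrite in_setU1 negb_or => /andP[_ yP].
by case/setU1P: xP => [-> | xP]; [apply: maxi; rewrite in_setC | apply: upP].
Qed.

Lemma exists_min P Q : ~~ (Q \subset P) -> upper P ->
  exists2 i, i \in Q :\: P & {in Q, forall x, w i <= w x}.
Proof.
case/subsetPn => x0 x0Q x0P upP.
have x0D : x0 \in Q :\: P by rewrite inE x0P.
case: (arg_minnP w x0D) => i iD mini; exists i => // x xQ.
have [xP | xP] := boolP (x \in P); last by apply: mini; apply/setDP.
by apply: upP xP _; case/setDP: iD.
Qed.

Lemma exists_max P : P != setT ->
  exists2 i, i \notin P & {in ~: P, forall x, w x <= w i}.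
Proof.
rewrite -subTset => /subsetPn[x0 _ x0P].
have x0D : x0 \in ~: P by rewrite inE.
by case: (arg_maxnP w x0D) => i /setCP/negP iP maxi; exists i.
Qed.

(** Constant sum: [wt P + wt (~: P) = 2 * q - 1], so [A] loses exactly when [P :\: A] together with
    [~: P] wins. *)
Lemma undecidedC P A : A \in undecided P -> P :\: A \in undecided P.
Proof.
rewrite !inE subsetDl => /and3P[sAP]; have := wtD sAP; have := wtC P; lia.
Qed.

(** * The effect of one more player choosing *)

Section AddPlayer.

Variables (P : {set N}) (i : N).
Hypotheses (upP : upper P) (iP : i \notin P).

Lemma wtC_add : wt (~: P) = w i + wt (~: (i |: P)).
Proof. by rewrite (wtD1 (i := i)) ?inE // setCU setIC -setDE. Qed.

Lemma completed_undecided : completed P i \subset undecided P.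
Proof.
apply/subsetP => A; rewrite !inE => /andP[-> /eqP] /=.
by have := wtC_add; have := w_gt0 i; lia.
Qed.

(** The upper bound is unchanged, as [i] only moves from the remaining players into the coalition;
    by [losing_add_lighter], a losing [A] joined by [i] still loses or meets [q] exactly. *)
Lemma undecided_add A : A \subset P ->
  (i |: A \in undecided (i |: P)) = (A \in undecided P :\: completed P i).
Proof.
move=> sAP; have iA : i \notin A by apply: contra iP; apply: (subsetP sAP).
rewrite !inE sAP setUS //= wtU1 //.
have := @losing_add_lighter i A iA; have := wtC_add; have := w_gt0 i => w0 wC.
have [ltA | ] := ltnP (wt A) q; last by lia.
move/(_ (fun x xA => upP (subsetP sAP x xA) iP) isT); lia.
Qed.

(** Complementation in [i |: P] exchanges the coalitions without [i] and those with [i]. *)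
Lemma undecided_skip A : A \subset P ->
  (A \in undecided (i |: P)) = (P :\: A \in undecided P :\: completed P i).
Proof.
move=> sAP; rewrite -undecided_add ?subsetDl //.
have iA : i \notin A by apply: contra iP; apply: (subsetP sAP).
have E B : B \subset P -> i |: P :\: B = (i |: P) :\: B.
  move=> sBP; apply/setP => x; rewrite !inE.
  by case: eqP => // ->; rewrite (contra (subsetP sBP i)).
have E2 : A = (i |: P) :\: (i |: (P :\: A)).
  apply/setP => x; rewrite !inE negb_or negb_and negbK.
  have [-> | _] /= := eqVneq x i; first by rewrite (negbTE iA).
  by case xA: (x \in A); rewrite /= ?andNb ?(subsetP sAP).
apply/idP/idP => [/undecidedC | /undecidedC]; first by rewrite E.
by rewrite -E2.
Qed.

(** Each undecided [A] that is not completed has two descendants, [i |: A] and [P :\: A], and these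
    exhaust [undecided (i |: P)]. *)
Lemma card_undecided_add :
  #|undecided (i |: P)| + 2 * #|completed P i| = 2 * #|undecided P|.
Proof.
pose X := undecided P :\: completed P i.
have XP A : A \in X -> A \subset P by rewrite !inE => /and3P[].
have iX A : A \in X -> i \notin A.
  by move/XP/subsetP => sAP; apply: contra iP; apply: sAP.
have -> : undecided (i |: P) =
    [set i |: A | A in X] :|: [set P :\: A | A in X].
  apply/setP => B; rewrite in_setU; apply/idP/idP.
    move=> uB; have sB : B \subset i |: P by move: uB; rewrite inE => /andP[].
    have [iB | iB] := boolP (i \in B).
      apply/orP; left; apply/imsetP; exists (B :\ i); last by rewrite setD1K.
      by rewrite -undecided_add ?setD1K // subDset.
    have sBP : B \subset P.
      apply/subsetP => x xB; have /setU1P[xi | //] := subsetP sB x xB.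
      by rewrite -xi xB in iB.
    apply/orP; right; apply/imsetP; exists (P :\: B).
      by rewrite -undecided_skip.
    by rewrite setDDK.
  case/orP => /imsetP[A XA ->]; first by rewrite undecided_add ?XP.
  by rewrite undecided_skip ?subsetDl // setDDK ?XP.
rewrite cardsU disjoint_setI0 ?cards0; last first.
  rewrite disjoint_subset; apply/subsetP => B /imsetP[A XA ->].
  rewrite inE; apply/imsetP => -[A' _ /setP/(_ i)].
  by rewrite !inE eqxx (negbTE iP) andbF.
rewrite !card_in_imset; first last.
- move=> A B XA XB eqAB; rewrite -(setU1K (iX _ XA)) eqAB setU1K ?iX //.
- move=> A B /XP sA /XP sB eqAB.
  by rewrite -(setDDK sA) eqAB setDDK.
rewrite cardsD (setIidPr completed_undecided).
by have := subset_leq_card completed_undecided; lia.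
Qed.

Lemma card_won_add : #|won_in (i |: P)| = #|won_in P| + #|completed P i|.
Proof.
have -> : won_in (i |: P) = won_in P :|: [set i |: A | A in completed P i].
  apply/setP => B; rewrite !inE; apply/idP/idP.
    case/andP=> sB wB.
    have [iB | iB] := boolP (i \in B).
      apply/orP; right; apply/imsetP; exists (B :\ i); last by rewrite setD1K.
      by rewrite inE -wtD1 // wB subDset sB.
    apply/orP; left; rewrite wB andbT.
    apply/subsetP => x xB; have /setU1P[xi | //] := subsetP sB x xB.
    by rewrite -xi xB in iB.
  case/orP => [/andP[sBP ->] | /imsetP[A]].
    by rewrite (subset_trans sBP) // subsetUr.
  rewrite inE => /andP[sAP wA] ->; rewrite setUS // wtU1 //.
  by apply: contra iP; apply: (subsetP sAP).
rewrite cardsU disjoint_setI0 ?cards0 ?subn0.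
  rewrite card_in_imset // => A B; rewrite !inE => /andP[sA _] /andP[sB _] eqAB.
  rewrite -(@setU1K _ i A) ?eqAB ?setU1K //; apply: contra iP.
    exact: (subsetP sB).
  exact: (subsetP sA).
rewrite disjoint_subset; apply/subsetP => B; rewrite !inE => /andP[sB _].
apply/imsetP => -[A _ eqB]; case/negP: iP; apply: (subsetP sB).
by rewrite eqB setU11.
Qed.

End AddPlayer.

(** * A potential that counts minimal winning coalitions *)

(** The factor 2 makes the [completed] terms of [card_won_add] and [card_undecided_add] cancel. *)
Definition potential P := 2 * #|won_in P| + #|undecided P|.

Lemma potential_add P i : upper P -> i \notin P ->
  potential (i |: P) = potential P + #|undecided P|.
Proof.
move=> upP iP; rewrite /potential card_won_add //.
by have := card_undecided_add upP iP; lia.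
Qed.

Lemma card_undecided0 : #|undecided set0| = 1.
Proof.
rewrite (_ : undecided set0 = [set set0]) ?cards1 //.
apply/setP => A; rewrite !inE subset0; case: eqP => //= ->.
by have := wtC set0; rewrite wt0; have := q_gt0; lia.
Qed.

Lemma potential0 : potential set0 = 1.
Proof.
rewrite /potential card_undecided0 (_ : won_in set0 = set0) ?cards0 //.
apply/setP => A; rewrite !inE subset0; case: eqP => //= ->.
by rewrite wt0; have := q_gt0; lia.
Qed.

Lemma undecidedT : undecided setT = set0.
Proof. by apply/setP => A; rewrite !inE setCT wt0; lia. Qed.

Lemma potentialT : potential setT = 2 * #|N|.
Proof.
rewrite /potential undecidedT cards0 addn0.
congr (2 * _); rewrite -card_wt_eq_quota.
by apply: eq_card => S; rewrite !inE subsetT.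
Qed.

Lemma setU1_neq0 i A : i |: A != set0.
Proof. by apply/set0Pn; exists i; rewrite setU11. Qed.

(** Positive: if a player outside [P] is pivotal for [S], then [S :&: P] is undecided. Even: [P]
    arises by adding its lightest player, and [card_undecided_add] applies. *)
Lemma card_undecided_ge2 P :
  upper P -> P != set0 -> P != setT -> 1 < #|undecided P|.
Proof.
move=> upP P0 PT.
have : 0 < #|undecided P|.
  have [i iP _] := exists_max PT; have [S iS /andP[ltS leS]] := not_dummyP i.
  apply/card_gt0P; exists (S :&: P); rewrite inE subsetIr /=.
  rewrite (leq_ltn_trans (wtS (subsetIl _ _)) ltS) /=.
  apply: leq_trans leS _; rewrite -wtU.
    apply: wtS; apply/subsetP => x; rewrite !inE.
    by case/predU1P => [-> | ->]; rewrite ?iP ?orbT // orbN.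
  by rewrite disjoints_subset setCK subsetIr.
rewrite -subset0 in P0; have [i iP mini] := exists_min P0 upper0.
rewrite setD0 in iP; rewrite -(setD1K iP).
have := card_undecided_add (upperD1_min upP mini) (negbT (setD11 i P)); lia.
Qed.

Lemma potential_growth P Q : upper P -> upper Q -> P != set0 -> P \subset Q ->
  potential P + 2 * #|Q :\: P| <= potential Q.
Proof.
move=> upP upQ P0; move En: #|Q :\: P| => n.
elim: n Q upQ En => [|n IHn] Q upQ En sPQ.
  have: Q \subset P by rewrite -setD_eq0 -cards_eq0 En.
  by move=> sQP; rewrite (_ : Q = P) ?addn0 //; apply/eqP;
     rewrite eqEsubset sQP.
have nsQP : ~~ (Q \subset P) by rewrite -setD_eq0 -cards_eq0 En.
(* Removing a lightest player of [Q], chosen outside [P], keeps [upper]; putting it back adds at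
   least 2. *)
have [i /setDP[iQ iP] mini] := exists_min nsQP upP.
have upQ' := upperD1_min upQ mini.
have sPQ' : P \subset Q :\ i by rewrite subsetD1 sPQ.
have := potential_add upQ' (negbT (setD11 i Q)); rewrite setD1K // => ->.
have := IHn _ upQ' _ sPQ'.
have: 1 < #|undecided (Q :\ i)|.
  apply: card_undecided_ge2 => //.
    by apply: contraNneq P0 => Q0; rewrite -subset0 -Q0.
  by apply/eqP => /setP/(_ i); rewrite !inE eqxx.
have -> : #|(Q :\ i) :\: P| = n.
  move: En; rewrite (cardsD1 i) inE iQ iP => -[<-].
  by rewrite !setDDl setUC.
by move=> ? /(_ erefl); lia.
Qed.

(** The heaviest player of [P] alone has potential 1 + 1 = 2, and each further player adds at least
    2. *)
Lemma potential_ge P : upper P -> P != set0 -> 2 * #|P| <= potential P.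
Proof.
move=> upP P0.
have [|i] := @exists_max (~: P); first by rewrite -setC0 (inj_eq (@setC_inj N)).
rewrite inE negbK setCK => iP maxi.
have upi : upper [set i].
  rewrite -[[set i]]setU0; apply: upperU1_max upper0 _ => x _.
  by have [/maxi | /(upP i x iP)] := boolP (x \in P).
have i0 : [set i] != set0 by apply/set0Pn; exists i; rewrite inE.
have siP : [set i] \subset P by rewrite sub1set.
have := potential_growth upi upP i0 siP.
have -> : potential [set i] = 2.
  by rewrite -[[set i]]setU0 (potential_add upper0) ?inE //
             potential0 card_undecided0.
by rewrite (cardsD1 i P) iP; lia.
Qed.

(* The potential ends at twice the number of minimal winning coalitions, so
   having only #|N| of them leaves no slack at any step. *)
Lemma card_undecided P :
  upper P -> P != set0 -> P != setT -> #|undecided P| = 2.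
Proof.
move=> upP P0 PT; have ge2 := card_undecided_ge2 upP P0 PT.
have [i iP maxi] := exists_max PT.
have iP0 := setU1_neq0 i P.
have := potential_growth (upperU1_max upP maxi) upperT iP0 (subsetT _).
rewrite potentialT potential_add // setTD.
have := potential_ge upP P0.
by have := cardsC (i |: P); rewrite cardsU1 iP; lia.
Qed.

(** * Weight identities from the two undecided coalitions *)

Lemma upper_neqT P i : i \notin P -> P != setT.
Proof. by move=> iP; apply: contraNneq iP => ->; rewrite inE. Qed.

Lemma card_undecided_le2 P : upper P -> P != set0 -> #|undecided P| <= 2.
Proof.
move=> upP P0; have [-> | PT] := eqVneq P setT.
  by rewrite undecidedT cards0.
by rewrite card_undecided.
Qed.

(* Once i joins P, the undecided coalitions are A and its complement, where
   A + i exactly meets the quota; then j must complete that complement. *)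
Lemma weight_step P i j :
    upper P -> P != set0 -> i \notin P -> upper (i |: P) ->
    j \notin i |: P -> upper (j |: (i |: P)) -> w i != w j ->
  w i = 1 + wt (~: (j |: (i |: P))).
Proof.
move=> upP P0 iP upiP jP upjiP wij.
have cP := card_undecided upP P0 (upper_neqT iP).
have ciP := card_undecided upiP (setU1_neq0 _ _) (upper_neqT jP).
have := card_undecided_add upP iP; rewrite cP ciP => c1.
have {c1} /eqP/cards1P[A cA] : #|completed P i| = 1 by clear -c1; lia.
have: A \in completed P i by rewrite cA set11.
rewrite inE => /andP[sAP /eqP wA].
set B := P :\: A.
have wP : wt P = wt A + wt B := wtD sAP.
have AB : A != B.
  by apply: contraNneq P0 => /setD_fixed ->.
have uA : A \in undecided P.
  by apply: (subsetP (completed_undecided iP)); rewrite cA set11.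
have uB : B \in undecided P :\: completed P i.
  by rewrite inE undecidedC // cA inE eq_sym AB.
have uA' : A \in undecided (i |: P) by rewrite undecided_skip.
have uB' : i |: B \in undecided (i |: P) by rewrite undecided_add ?subsetDl.
have iA : i \notin A by apply: contra iP; apply: (subsetP sAP).
have iB : i \notin B by rewrite inE negb_and iP orbT.
have neq : A != i |: B by apply: contraNneq iA => ->; rewrite setU11.
have cU : undecided (i |: P) = [set A; i |: B].
  apply/eqP; rewrite eq_sym eqEcard ciP cards2 neq andbT.
  by apply/subsetP => X /set2P[] ->.
have := card_undecided_add upiP jP; rewrite ciP.
have := card_undecided_le2 upjiP (setU1_neq0 _ _) => le2 c2.
have /card_gt0P[C cC] : 0 < #|completed (i |: P) j| by clear -le2 c2; lia.
have uC := subsetP (completed_undecided jP) C cC.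
have wC : w j + wt C = q by move: cC; rewrite inE => /andP[_ /eqP].
(* [C = A] would give [w j = w i]. Hence [C = i |: B], and the sum of the two quota equations for
   [A] and [B] is compared with [wtC P]. *)
move: uC wC; rewrite cU => /set2P[] -> wC.
  by case/eqP: wij; clear -wA wC; lia.
rewrite wtU1 // in wC.
by have := wtC P; rewrite (wtC_add iP) (wtC_add jP); clear -wA wC wP; lia.
Qed.

Lemma quota_top_two i j :
  upper [set i] -> j \notin [set i] -> upper (j |: [set i]) -> q = w i + w j.
Proof.
move=> upi ji upji.
have i0 : [set i] != set0 by apply/set0Pn; exists i; rewrite inE.
have := card_undecided_add upi ji.
rewrite (card_undecided upi i0 (upper_neqT ji)).
have := card_undecided_le2 upji (setU1_neq0 _ _) => le2 c2.
have /card_gt0P[C] : 0 < #|completed [set i] j| by clear -le2 c2; lia.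
rewrite inE subset1 => /andP[/orP[] /eqP-> /eqP].
  by rewrite wt1 addnC.
have := upi i j (set11 i) ji; have := w_gt0 i.
by have := wtC [set i]; rewrite (wtC_add ji) wt0 wt1; lia.
Qed.

(** Otherwise [q = 2 * w i], and the next player [k] completes a unique part [C] of the top pair.
    Both [C] and the rest of the pair weigh at least [w i], which forces [w k = w i], so [k]
    completes the rest as well. *)
Lemma top_weight_unique i j :
  upper [set i] -> j \notin [set i] -> upper (j |: [set i]) -> w j < w i.
Proof.
move=> upi ji upji; rewrite ltn_neqAle upi ?set11 // andbT.
apply/eqP => wji; have qE := quota_top_two upi ji upji.
set P := j |: [set i] in upji *.
have wP : wt P = q by rewrite wtU1 // wt1 qE addnC.
have cP : #|P| = 2 by rewrite cardsU1 ji cards1.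
have wPx x : x \in P -> w x = w i by case/set2P => ->.
have iP : i \in P by rewrite !inE eqxx orbT.
have P0 : P != set0 by apply: setU1_neq0.
clearbody P; have gt3 := cardN_gt3.
(* With more than three players, both the pair and the pair with [k] are proper segments, so
   [card_undecided] covers them. *)
have neqT Q : #|Q| < 4 -> Q != setT.
  by apply: contraTneq => ->; rewrite cardsT; lia.
have [k kP maxk] : exists2 k, k \notin P & {in ~: P, forall x, w x <= w k}.
  by apply: exists_max; apply: neqT; rewrite cP.
have upk := upperU1_max upji maxk.
have := card_undecided_add upji kP.
rewrite !card_undecided ?setU1_neq0 ?neqT ?cardsU1 ?kP ?cP // => c1.
have {c1} /eqP/cards1P[C cC] : #|completed P k| = 1 by clear -c1; lia.
have: C \in completed P k by rewrite cC set11.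
rewrite inE => /andP[sCP /eqP wC].
have wki := upji i k iP kP.
have wk0 := w_gt0 k; have wi0 := w_gt0 i.
have wD := wtD sCP; rewrite wP in wD.
have lb A : A \subset P -> 0 < wt A -> w i <= wt A.
  move=> sAP; have [-> | [x xA] _] := set_0Vmem A; first by rewrite wt0.
  by rewrite (wtD1 xA) (wPx x) ?leq_addr // (subsetP sAP).
have lbC := lb C sCP; have lbD := lb _ (subsetDl P C).
have: P :\: C \in completed P k by rewrite inE subsetDl; apply/eqP; lia.
rewrite cC => /set1P eqC.
by move: wP; rewrite (setD_fixed (esym eqC)) wt0; have := q_gt0; lia.
Qed.

(** * Type weights and the players below a type *)

Local Notation tw := (type_weight w).
Local Notation h := (num_types w).

Lemma type_weight_ltn s t : s < t <= h -> tw s < tw t.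
Proof.
case/andP=> st th.
have sortedT : sorted ltn (0 :: type_weights w).
  (* Positivity of the weights lets the conventional weight 0 head the strictly increasing list. *)
  rewrite /= path_min_sorted; last first.
    apply/allP => x; rewrite mem_sort mem_undup => /mapP[y _ ->].
    exact: w_gt0.
  by rewrite ltn_sorted_uniq_leq sort_uniq undup_uniq (sort_sorted leq_total).
apply: (sorted_ltn_nth ltn_trans 0 sortedT) => //; rewrite inE /= ltnS //.
exact: leq_trans (ltnW st) th.
Qed.

Lemma type_weight_leq s t : s <= t <= h -> tw s <= tw t.
Proof.
case/andP; rewrite leq_eqVlt => /predU1P[-> // | st th].
exact/ltnW/type_weight_ltn/andP.
Qed.

Lemma type_of_player x : exists2 t, 0 < t <= h & w x = tw t.
Proof.
have xT : w x \in type_weights w.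
  by rewrite mem_sort mem_undup map_f ?mem_enum.
exists (index (w x) (type_weights w)).+1; first by rewrite /= index_mem.
by rewrite /type_weight /= nth_index.
Qed.

Lemma player_of_type t : 0 < t <= h -> exists x, w x = tw t.
Proof.
case: t => // t /= th; have := mem_nth 0 th.
by rewrite mem_sort mem_undup => /mapP[x _ E]; exists x.
Qed.

Lemma type_gap t x : t < h -> (w x < tw t.+1) = (w x <= tw t).
Proof.
move=> th; have [u /andP[u0 uh] ->] := type_of_player x.
have [ut | tu] := leqP u t.
  have := @type_weight_ltn u t.+1; have := @type_weight_leq u t.
  by rewrite ltnS ut th ltnW // => -> // ->.
have := @type_weight_leq t.+1 u; have := @type_weight_ltn t u.
by rewrite tu uh => /(_ isT) lt_tu /(_ isT) le_tu; lia.
Qed.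

Definition below t := [set x | w x < tw t].

Lemma wt_below_succ t : 0 < t < h ->
  wt (below t.+1) = wt (below t) + type_size w t * tw t.
Proof.
case/andP=> t0 th; have -> : below t.+1 = below t :|: [set x | w x == tw t].
  by apply/setP => x; rewrite !inE type_gap // leq_eqVlt orbC.
rewrite wtU; last first.
  by rewrite disjoint_subset; apply/subsetP => x; rewrite !inE => /ltn_eqF ->.
congr (_ + _); rewrite /coalition_weight.
rewrite (eq_bigr (fun=> tw t)); last by move=> x; rewrite inE => /eqP.
by rewrite sum_nat_const.
Qed.

Lemma type_weight1 : tw 1 = 1.
Proof.
have [[x wx] _ _ _] := w_rep; have [t /andP[t0 th] wt1] := type_of_player x.
have := @type_weight_leq 1 t; rewrite t0 th -wt1 wx => /(_ isT).
have := @type_weight_ltn 0 1; rewrite (leq_trans t0 th) => /(_ isT) /=; lia.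
Qed.

Lemma wt_below1 : wt (below 1) = 0.
Proof.
rewrite (_ : below 1 = set0) ?wt0 //; apply/setP => x.
by rewrite !inE type_weight1; have := w_gt0 x; lia.
Qed.

(** * Balance equations between consecutive types *)

(** Apply [weight_step] to the last player [i] of one type and the first player [j] of the type
    below; adding [w j] turns the players after [j] into all those lighter than [i]. The strict
    bound keeps a heavier player in the segment. *)
Lemma type_balance t : t.+1 < h -> tw t.+1 + tw t = 1 + wt (below t.+1).
Proof.
case: t => [|t] th; first by rewrite type_weight1 wt_below1.
have [i wi] := @player_of_type t.+2 (ltnW th).
have [|j wj] := @player_of_type t.+1; first lia.
have [|k wk] := @player_of_type h; first by rewrite leqnn andbT; lia.
set Q := [set x | tw t.+2 <= w x].
have upQ : upper Q by move=> x y; rewrite !inE; lia.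
have iQ : i \in Q by rewrite inE wi.
have upP : upper (Q :\ i) by apply: upperD1_min => // x; rewrite inE wi.
have P0 : Q :\ i != set0.
  have ltk : w i < w k by rewrite wi wk type_weight_ltn // th leqnn.
  apply/set0Pn; exists k; rewrite !inE -wi (ltnW ltk) andbT.
  by apply: contraTneq ltk => ->; rewrite ltnn.
have wji : w j < w i by rewrite wi wj type_weight_ltn // leqnn ltnW.
have jQ : j \notin Q by rewrite inE -wi -ltnNge.
have upj : upper (j |: Q).
  apply: upperU1_max => // x; rewrite !inE -ltnNge wj type_gap //.
  by rewrite ltnW.
have := @weight_step (Q :\ i) i j upP P0 (negbT (setD11 _ _)).
rewrite setD1K // => /(_ upQ jQ upj); rewrite (gtn_eqF wji) => /(_ isT).
have -> : below t.+2 = ~: Q by apply/setP => x; rewrite !inE ltnNge.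
by rewrite (wtC_add jQ) -wi -wj; lia.
Qed.

(** The heaviest player [i] is alone in its type, so [below h] is its complement and the second
    heaviest [k] has type [h.-1]; insert [q = w i + w k] into [wtC [set i]]. *)
Lemma quota_balance : 1 < h -> q + tw h.-1 = 1 + wt (below h).
Proof.
move=> h2; have [|i wi] := @player_of_type h; first by rewrite leqnn andbT ltnW.
have lei x : w x <= w i.
  have [t /andP[_ th] ->] := type_of_player x.
  by rewrite wi type_weight_leq ?th /=.
have upi : upper [set i] by move=> x y /set1P ->.
have [|k ki maxk] := @exists_max [set i].
  apply: contraTneq cardN_gt3 => eqT.
  by rewrite -cardsT -eqT cards1.
have upk := upperU1_max upi maxk.
have wki := top_weight_unique upi ki upk.
have hE : h.-1.+1 = h by rewrite prednK // ltnW.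
have lt_h : h.-1 < h by rewrite hE.
have wk : w k = tw h.-1.
  apply/eqP; rewrite eqn_leq -type_gap // hE -wi wki /=.
  have [|j wj] := @player_of_type h.-1; first by lia.
  rewrite -wj maxk // !inE; apply: contraTneq lt_h => ji.
  have := @type_weight_ltn h.-1 h; rewrite -wj ji wi ltnn leqnn andbT.
  by case: (h.-1 < h) => // /(_ isT).
have := wtC [set i]; have qE := quota_top_two upi ki upk.
have -> : ~: [set i] = below h.
  apply/setP => x; rewrite !inE -wi; have [-> | xi] := eqVneq x i.
    by rewrite ltnn.
  by rewrite (leq_ltn_trans (maxk x _) wki) ?inE.
by rewrite -wk wt1; lia.
Qed.

(** * The recurrence for type weights and quota *)

Lemma type_weight_rec t : t.+2 < h ->
  tw t.+2 = type_size w t.+1 * tw t.+1 + tw t.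
Proof.
move=> th; apply: (@addIn (tw t.+1)).
have wt_succ := wt_below_succ (t := t.+1) (ltnW th).
rewrite (type_balance th) wt_succ addnA -(type_balance (ltnW th)).
by rewrite -[RHS]addnA [RHS]addnC [tw t + _]addnC.
Qed.

(** In the balance at [h] the quota stands where a type weight would, so the recurrence continues
    with [q], not with the top weight, which is smaller by [tw h.-1]. *)
Lemma quota_rec t : t.+2 = h -> q = type_size w t.+1 * tw t.+1 + tw t.
Proof.
move=> th; apply: (@addIn (tw t.+1)).
have lt_h : t.+1 < h by rewrite -th.
have := quota_balance; rewrite -th => -> //=.
have wt_succ := wt_below_succ (t := t.+1) lt_h.
rewrite wt_succ addnA -(type_balance lt_h).
by rewrite -[RHS]addnA [RHS]addnC [tw t + _]addnC.
Qed.

End Parsimonious.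

Theorem theorem3p1 (N : finType) (v : {set N} -> bool) (q : nat) (w : N -> nat)
    (h : nat) (s : nat -> nat) :
  parsimonious v ->
  minimal_homogeneous_representation v q w ->
  num_types w = h ->
  2 <= h ->
  solves_difference_equation (type_size w) h s ->
  q = s h.
Proof.
move=> pv rep hE; subst h => h2 [s0 s1 srec].
(* Order two requires carrying two consecutive values; the agreement of type weights with [s] is
   claimed only up to [h.-1]. *)
have sE t : t.+1 < num_types w ->
    type_weight w t = s t /\ type_weight w t.+1 = s t.+1.
  elim: t => [_ | t IHt th]; first by rewrite s0 s1 (type_weight1 pv rep).
  have [IH0 IH1] := IHt (ltnW th); split=> //.
  by rewrite (type_weight_rec pv rep th) srec /= ?IH0 ?IH1 // ltnW.
case hE: (num_types w) h2 => [|[|t]] // _.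
have [w0 w1] : type_weight w t = s t /\ type_weight w t.+1 = s t.+1.
  by apply: sE; rewrite hE.
by rewrite srec ?hE ?leqnn //= (quota_rec pv rep (esym hE)) w0 w1.
Qed.
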